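(* The class of subcubic graphs is not the $\sqsubseteq_{\rm FO}$-minimum class of unbounded twin-width. That is, it is not true that the class of all subcubic graphs is a transduction of every class of graphs of unbounded twin-width.
   Context: Graphs are finite, undirected and loopless; a class of graphs is a set of graphs considered up to isomorphism, and every class contains the empty graph. A graph is subcubic if all its vertices have degree at most $3$. For a set $\mathcal U$ of unary relation symbols, a $\mathcal U$-colored graph is a graph with additional unary relations in $\mathcal U$. Formulas are first-order, with adjacency relation $E$. Twin-width. A trigraph is a graph whose edges are each colored black or red. Contracting two (not necessarily adjacent) vertices $u,v$ of a trigraph into a vertex $w$ gives a trigraph in which, for every other vertex $x$: $wx$ is a black edge if $ux$ and $vx$ are both black edges; $wx$ is a non-edge if $ux$ and $vx$ are both non-edges; $wx$ is a red edge otherwise; other adjacencies are unchanged. The twin-width of $G$ is the least $d$ such that $G$ (with all edges black) can be reduced to a single vertex by contractions with all intermediate trigraphs having maximum red degree at most $d$. A class has unbounded twin-width if no constant bounds the twin-width of its graphs. Transductions. For a positive integer $k$, the $k$-copy operation $\mathsf C_k$ maps a graph $G$ to the graph consisting of $k$ copies of $G$ in which the $k$ copies of each vertex are made pairwise adjacent (no other edges between the copies). The coloring operation $\Gamma_{\mathcal U}$ maps a graph to the set of all its $\mathcal U$-expansions. A simple interpretation $\mathsf I=(\nu(x),\eta(x,y))$ of graphs in $\mathcal U$-colored graphs is a pair of first-order formulas with $\eta$ symmetric and anti-reflexive; $\mathsf I(G^+)$ is the graph with vertex set $\nu(G^+)$ and edge set $\eta(G^+)\cap\nu(G^+)^2$.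 A transduction is a composition $\mathsf T=\mathsf I\circ\Gamma_{\mathcal U}\circ\mathsf C_k$, so $\mathsf T(G)=\{\mathsf I(G^+): G^+\in\Gamma_{\mathcal U}(\mathsf C_k(G))\}$. For a class $\mathscr D$, $\mathsf T(\mathscr D)=\bigcup_{G\in\mathscr D}\mathsf T(G)$ up to isomorphism. $\mathscr C\sqsubseteq_{\rm FO}\mathscr D$ (''$\mathscr C$ is a transduction of $\mathscr D$'') means $\mathscr C\subseteq\mathsf T(\mathscr D)$ for some transduction $\mathsf T$. A minimum class of unbounded twin-width is a class of unbounded twin-width that is $\sqsubseteq_{\rm FO}$ every class of unbounded twin-width. *)

(* Defs.v *)
From mathcomp Require Import all_boot.
From mathcomp Require Import boolp.

Set Implicit Arguments.
Unset Strict Implicit.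
Unset Printing Implicit Defensive.

Record graph := Graph {
  vertex :> finType;
  adj : rel vertex;
  adj_sym : symmetric adj;
  adj_irrefl : irreflexive adj }.

Definition graph_iso (G H : graph) : Prop :=
  exists2 f : G -> H, bijective f & {mono f : x y / adj x y}.

Record graph_class := GraphClass {
  in_class :> graph -> Prop;
  class_iso : forall G H, graph_iso G H -> in_class G -> in_class H;
  class_empty : forall G : graph, #|G| = 0 -> in_class G }.

Definition degree (G : graph) (x : G) : nat := #|[set y | adj x y]|.

Definition subcubic (G : graph) : Prop := forall x : G, degree x <= 3.

Lemma subcubic_iso (G H : graph) : graph_iso G H -> subcubic G -> subcubic H.
Proof.
move=> [f [g fK gK] fE] sG y; apply: leq_trans (sG (g y)).
rewrite /degree -(card_imset _ (can_inj gK)); apply: subset_leq_card.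
apply/subsetP=> _ /imsetP[z + ->]; rewrite !inE => yz.
by rewrite -fE !gK.
Qed.

Lemma subcubic_empty (G : graph) : #|G| = 0 -> subcubic G.
Proof. by move=> G0 x; move: (fintype0 x G0). Qed.

Definition subcubic_graphs : graph_class :=
  GraphClass subcubic_iso subcubic_empty.

(* The black edges are a subset of the edges; the other edges are red. *)
Record trigraph := Trigraph {
  tgraph :> graph;
  black : rel tgraph;
  black_sym : symmetric black;
  black_adj : forall x y, black x y -> adj x y }.

Definition red (H : trigraph) : rel H := fun x y => adj x y && ~~ black x y.

Definition red_degree (H : trigraph) (x : H) : nat := #|[set y | red x y]|.

Definition max_red_degree (H : trigraph) : nat := \max_(x : H) red_degree x.

Lemma black_graph_subproof (G : graph) (x y : G) : adj x y -> adj x y.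
Proof. by []. Qed.

Definition black_trigraph (G : graph) : trigraph :=
  Trigraph (@adj_sym G) (@black_graph_subproof G).

(* The contraction of u and v deletes v, and u plays the role of the new
   vertex w. *)
Section Contraction.
Variables (H : trigraph) (u v : H).

Definition contract_vertex : finType := {x : H | x != v}.

(* wx is an edge, black or red, iff ux or vx is an edge. *)
Definition contract_adj : rel contract_vertex := fun a b =>
  let x := val a in let y := val b in
  (x != y) && [|| adj x y, (x == u) && adj v y | (y == u) && adj x v].

(* wx is a black edge iff ux and vx are both black edges. *)
Definition contract_black : rel contract_vertex := fun a b =>
  let x := val a in let y := val b in
  [&& black x y, (x == u) ==> black v y & (y == u) ==> black x v].

Lemma contract_adj_sym : symmetric contract_adj.
Proof.
move=> a b; rewrite /contract_adj eq_sym (adj_sym (val a)) (adj_sym v).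
by rewrite (adj_sym v) [(_ == u) && _ || _]orbC.
Qed.

Lemma contract_adj_irrefl : irreflexive contract_adj.
Proof. by move=> a; rewrite /contract_adj eqxx. Qed.

Lemma contract_black_sym : symmetric contract_black.
Proof.
move=> a b; rewrite /contract_black (black_sym (val a)) (black_sym v).
by rewrite (black_sym v) [(_ ==> _) && _]andbC.
Qed.

Lemma contract_black_adj a b : contract_black a b -> contract_adj a b.
Proof.
case/and3P=> /black_adj ab _ _; rewrite /contract_adj ab andbT.
by apply: contraTneq ab => ->; rewrite adj_irrefl.
Qed.

Definition contract : trigraph :=
  @Trigraph (Graph contract_adj_sym contract_adj_irrefl)
            contract_black contract_black_sym contract_black_adj.

End Contraction.

(* Stopping at #|H| <= 1 rather than #|H| = 1 gives the empty graph
   twin-width 0. *)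
Inductive reducible (d : nat) : trigraph -> Prop :=
| reducible_stop (H : trigraph) :
    max_red_degree H <= d -> #|H| <= 1 -> reducible d H
| reducible_contract (H : trigraph) (u v : H) :
    max_red_degree H <= d -> u != v -> reducible d (contract u v) ->
    reducible d H.

Lemma max_red_degree_card (H : trigraph) : max_red_degree H <= #|H|.
Proof. by apply/bigmax_leqP => x _; apply: max_card. Qed.

Lemma reducible_card (d : nat) (H : trigraph) : #|H| <= d -> reducible d H.
Proof.
have [n] := ubnP #|H|; elim: n H => // n IHn H ltHn leHd.
have leRd := leq_trans (max_red_degree_card H) leHd.
have [|] := leqP #|H| 1; first exact: reducible_stop.
case/card_gt1P=> u [v [_ _ uDv]].
have ltcH : #|contract u v| < #|H|.
  rewrite [#|contract u v|]card_sig; apply: proper_card.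
  by apply/properP; split; [apply/subsetP | exists v; rewrite // inE eqxx].
apply: (reducible_contract (u := u) (v := v)) => //; apply: IHn.
  exact: leq_trans ltcH _.
exact: leq_trans (ltnW ltcH) leHd.
Qed.

Lemma twin_width_subproof (G : graph) :
  exists d, `[< reducible d (black_trigraph G) >].
Proof. by exists #|G|; apply/asboolP/reducible_card. Qed.

Definition twin_width (G : graph) : nat := ex_minn (twin_width_subproof G).

Definition unbounded_twin_width (C : graph_class) : Prop :=
  ~ exists d, forall G, C G -> twin_width G <= d.

(* [formula U n] is the type of formulas with free variables among n variables,
   indexed by 'I_n; a quantifier binds the variable of index 0 of its body and
   shifts the others by one. *)
Inductive formula (U : Type) (n : nat) : Type :=
| FEq of 'I_n & 'I_n
| FAdj of 'I_n & 'I_n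
| FColor of U & 'I_n
| FNot of formula U n
| FAnd of formula U n & formula U n
| FExists of formula U n.+1.

Record colored_graph (U : Type) := ColoredGraph {
  uncolored :> graph;
  color : U -> {set uncolored} }.

Definition env_cons (T : Type) (n : nat) (x : T) (e : 'I_n -> T) :
    'I_n.+1 -> T :=
  fun i => oapp e x (unlift ord0 i).

Fixpoint sat (U : Type) (G : colored_graph U) (n : nat) (f : formula U n) :
    ('I_n -> G) -> bool :=
  match f with
  | FEq i j => fun e => e i == e j
  | FAdj i j => fun e => adj (e i) (e j)
  | FColor c i => fun e => e i \in color G c
  | FNot f1 => fun e => ~~ sat f1 e
  | FAnd f1 f2 => fun e => sat f1 e && sat f2 e
  | FExists f1 => fun e => [exists x : G, sat f1 (env_cons x e)]
  end.

Definition sat1 (U : Type) (G : colored_graph U) (f : formula U 1) : pred G :=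
  fun x => sat f (fun=> x).

Definition sat2 (U : Type) (G : colored_graph U) (f : formula U 2) : rel G :=
  fun x y => sat f (tnth [tuple x; y]).

Section Copy.
Variables (k : nat) (G : graph).

Definition copy_adj : rel (G * 'I_k)%type := fun a b =>
  ((a.2 == b.2) && adj a.1 b.1) || ((a.1 == b.1) && (a.2 != b.2)).

Lemma copy_adj_sym : symmetric copy_adj.
Proof.
by move=> a b; rewrite /copy_adj adj_sym (eq_sym a.2) (eq_sym a.1).
Qed.

Lemma copy_adj_irrefl : irreflexive copy_adj.
Proof. by move=> a; rewrite /copy_adj !eqxx adj_irrefl. Qed.

Definition copy : graph := Graph copy_adj_sym copy_adj_irrefl.

End Copy.

Record interpretation (U : Type) := Interpretation {
  nu : formula U 1;
  eta : formula U 2;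
  eta_sym : forall G : colored_graph U, symmetric (sat2 (G := G) eta);
  eta_irrefl : forall G : colored_graph U, irreflexive (sat2 (G := G) eta) }.

Section Interpret.
Variables (U : Type) (I : interpretation U) (G : colored_graph U).

Definition interpret_vertex : finType := {x : G | sat1 (nu I) x}.

Definition interpret_adj : rel interpret_vertex :=
  fun a b => sat2 (eta I) (val a) (val b).

Lemma interpret_adj_sym : symmetric interpret_adj.
Proof. by move=> a b; apply: eta_sym. Qed.

Lemma interpret_adj_irrefl : irreflexive interpret_adj.
Proof. by move=> a; apply: eta_irrefl. Qed.

Definition interpret : graph := Graph interpret_adj_sym interpret_adj_irrefl.

End Interpret.

Record transduction := Transduction {
  copies : nat;
  copies_gt0 : 0 < copies;
  colors : Type;
  interp : interpretation colors }.

Definition transduces (T : transduction) (G H : graph) : Prop :=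
  exists col : colors T -> {set copy (copies T) G},
    graph_iso (interpret (interp T) (ColoredGraph col)) H.

Definition transduction_of (C D : graph_class) : Prop :=
  exists T : transduction, forall H, C H -> exists2 G, D G & transduces T G H.

Definition minimum_unbounded_twin_width (C : graph_class) : Prop :=
  unbounded_twin_width C /\
  forall D, unbounded_twin_width D -> transduction_of C D.

(* Main.v *)
Require Import Defs.
From mathcomp Require Import all_boot all_fingroup boolp zify.

Set Implicit Arguments.
Unset Strict Implicit.
Unset Printing Implicit Defensive.

(**
Let [G_j] be a [j]-regular graph of girth larger than [j * (j+1)^j].  Already
the first contraction of [G_j] creates red degree at least [j - 2], so the
[G_j] have unbounded twin-width.

Suppose that a fixed transduction produces all subcubic graphs from the [G_j].
Let [H] be the clique [K_N] with each vertex expanded into a path on [N]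
vertices, together with so many isolated vertices that [H] is too large to come
from [G_j] with small [j].  For large [j], the ball of radius [R] around the
[N^2] vertices of [G_j] carrying the expanded clique has fewer vertices than
the girth, hence is a forest, and some vertex [v] of it separates these
vertices in a balanced way.  An Ehrenfeucht-Fraisse game, played on one side
according to types and copying the opponent's move elsewhere, shows that the
edges of [H] across this partition only depend on a type of the first endpoint,
taken from a set whose size depends on the transduction only.  As [H] is
subcubic, boundedly many vertices of one part have a neighbor in the other
one, which is impossible when [N] is large.
*)

(** * Locality *)

Fixpoint rank (U : Type) (n : nat) (f : formula U n) : nat :=
  match f with
  | FNot f1 => rank f1
  | FAnd f1 f2 => maxn (rank f1) (rank f2)
  | FExists f1 => (rank f1).+1
  | _ => 0
  end.

(** The type [U] of colors may be infinite. A profile records membership only in the colors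
    occurring in [f], so the number of profiles is finite and depends on [f] alone. *)
Fixpoint profile (U : Type) (n : nat) (f : formula U n) : finType :=
  match f with
  | FColor _ _ => bool
  | FNot f1 => profile f1
  | FAnd f1 f2 => (profile f1 * profile f2)%type
  | FExists f1 => profile f1
  | _ => unit
  end.

Fixpoint profile_of (U : Type) (G : colored_graph U) (n : nat)
    (f : formula U n) (x : G) : profile f :=
  match f with
  | FColor c _ => x \in color G c
  | FNot f1 => profile_of f1 x
  | FAnd f1 f2 => (profile_of f1 x, profile_of f2 x)
  | FExists f1 => profile_of f1 x
  | _ => tt
  end.

Lemma env_cons0 (T : Type) n (x : T) (e : 'I_n -> T) : env_cons x e ord0 = x.
Proof. by rewrite /env_cons unlift_none. Qed.

Lemma env_consS (T : Type) n (x : T) (e : 'I_n -> T) i :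
  env_cons x e (lift ord0 i) = e i.
Proof. by rewrite /env_cons liftK. Qed.

Definition atomic_type (K : finType) (m : nat) : finType :=
  ({ffun 'I_m -> K} * {ffun 'I_m * 'I_m -> bool * bool})%type.

(** Hintikka types: a type of rank [q] consists of the atomic type and the set of types of rank
    [q - 1] of the one-point extensions. Being a [finType] built from [K], [q] and [m], its size is
    independent of the graph. *)
Fixpoint fo_type (K : finType) (q m : nat) : finType :=
  if q is q'.+1 then (atomic_type K m * {set fo_type K q' m.+1})%type
  else atomic_type K m.

Section Types.
Variables (G : graph) (K : finType) (kappa : G -> K) (S : {set G}).

Definition atomic m (a : 'I_m -> G) : atomic_type K m :=
  ([ffun i => kappa (a i)],
   [ffun ij : 'I_m * 'I_m => (adj (a ij.1) (a ij.2), a ij.1 == a ij.2)]).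

Fixpoint type_of (q m : nat) : ('I_m -> G) -> fo_type K q m :=
  if q is q'.+1
  then fun a => (atomic a, [set type_of q' (env_cons c a) | c in S])
  else @atomic m.

Lemma type_of_atomic q m (a a' : 'I_m -> G) :
  type_of q a = type_of q a' -> atomic a = atomic a'.
Proof. by case: q => [|q] //= /(congr1 fst). Qed.

Lemma type_of_color q m (a a' : 'I_m -> G) i :
  type_of q a = type_of q a' -> kappa (a i) = kappa (a' i).
Proof. by move/type_of_atomic=> [/ffunP/(_ i) + _]; rewrite !ffunE. Qed.

Lemma type_of_adj q m (a a' : 'I_m -> G) i j :
  type_of q a = type_of q a' -> adj (a i) (a j) = adj (a' i) (a' j).
Proof. by move/type_of_atomic=> [_ /ffunP/(_ (i, j))]; rewrite !ffunE => -[]. Qed.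

Lemma type_of_eq q m (a a' : 'I_m -> G) i j :
  type_of q a = type_of q a' -> (a i == a j) = (a' i == a' j).
Proof. by move/type_of_atomic=> [_ /ffunP/(_ (i, j))]; rewrite !ffunE => -[]. Qed.

Lemma type_of_forth q m (a a' : 'I_m -> G) c :
  type_of q.+1 a = type_of q.+1 a' -> c \in S ->
  exists2 c', c' \in S
    & type_of q (env_cons c a) = type_of q (env_cons c' a').
Proof.
case=> _ _ /setP/(_ (type_of q (env_cons c a))) eqS cS.
by apply/imsetP; rewrite -eqS; apply/imset_f.
Qed.

Lemma type_of_pred q m (a a' : 'I_m -> G) :
  type_of q.+1 a = type_of q.+1 a' -> type_of q a = type_of q a'.
Proof.
elim: q m a a' => [|q IHq] m a a' eqa; first exact: type_of_atomic eqa.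
congr pair; first exact: type_of_atomic eqa.
apply/setP=> t; apply/imsetP/imsetP=> -[c cS ->].
  by have [c' c'S /IHq] := type_of_forth eqa cS; exists c'.
by have [c' c'S /IHq] := type_of_forth (esym eqa) cS; exists c'.
Qed.

End Types.

Section Game.
Variables (U : Type) (G : colored_graph U) (K : finType) (kappa : G -> K).
Variables (S : {set G}) (lev : K -> nat) (R : nat).

Hypothesis lev_adj : forall x y, x \in S -> y \in S -> adj x y ->
  lev (kappa x) <= (lev (kappa y)).+1.
Hypothesis border_adj : forall x x' y, x \in S -> x' \in S -> y \notin S ->
  kappa x = kappa x' -> lev (kappa x) < R -> adj x y = adj x' y.

(** A variable sent to [inl j] denotes the pebble [j], which may differ on the two sides of the
    game; one sent to [inr y] denotes the same vertex [y] on both. *)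
Definition pick_value m (a : 'I_m -> G) (z : 'I_m + G) : G :=
  match z with inl j => a j | inr y => y end.

Definition far_from (l q : nat) m (z : 'I_m + G) : Prop :=
  match z with
  | inl j => True
  | inr y => y \in S -> l + 2 ^ q.+1 <= lev (kappa y)
  end.

(* Pebbles in [S] at level at most [l] are answered according to types, the
   others by the same vertex.  A gap of [2 ^ q.+1] levels separates the two
   kinds, and each of the [q] remaining moves at most halves it. *)
Lemma sat_local n (f : formula U n) :
  (forall x y, kappa x = kappa y -> profile_of f x = profile_of f y) ->
  forall q l m (a a' : 'I_m -> G) (z : 'I_n -> 'I_m + G) (e e' : 'I_n -> G),
  rank f <= q -> l + 2 ^ q.+1 <= R ->
  (forall j, a j \in S /\ lev (kappa (a j)) <= l) ->
  (forall j, a' j \in S) ->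
  type_of kappa S q a = type_of kappa S q a' ->
  (forall i, far_from l q (z i)) ->
  (forall i, e i = pick_value a (z i)) ->
  (forall i, e' i = pick_value a' (z i)) ->
  sat f e = sat f e'.
Proof.
elim: {n} f => [n i j|n i j|n c i|n f IHf|n f1 IH1 f2 IH2|n f IHf] /= resp
  q l m a a' z e e' rk lR aS a'S eqt far eE e'E.
- rewrite !eE !e'E; move: (far i) (far j).
  have neq b (bS : forall k, b k \in S /\ lev (kappa (b k)) <= l) k y :
      far_from (m := m) l q (inr y) -> (b k == y) = false.
    move=> /= fy; apply/eqP=> by_; have [] := bS k; rewrite by_ => /fy.
    by have := expn_gt0 2 q.+1; lia.
  have a'lev k : a' k \in S /\ lev (kappa (a' k)) <= l.
    by split=> //; rewrite -(type_of_color _ eqt); case: (aS k).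
  case: (z i) (z j) => [i'|y] [j'|y'] fi fj //=.
  + exact: type_of_eq eqt.
  + by rewrite !neq.
  + by rewrite eq_sym neq // eq_sym neq.
- rewrite !eE !e'E; move: (far i) (far j).
  (* Outside [S], [border_adj] applies, since the pebbles have level below [R]. Inside [S], the
     levels of [y] and of a pebble differ by at least 2, so by [lev_adj] there is no edge. *)
  have mixed k y : far_from (m := m) l q (inr y) -> adj (a k) y = adj (a' k) y.
    move=> /= fy; have [akS akl] := aS k; have ck := type_of_color k eqt.
    have [yS|yNS] := boolP (y \in S); last first.
      by apply: border_adj => //; have := expn_gt0 2 q.+1; lia.
    have lt2 : 2 <= 2 ^ q.+1 by rewrite expnS; have := expn_gt0 2 q; lia.
    have naj b : b \in S -> lev (kappa b) <= l -> adj b y = false.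
      move=> bS bl; apply/negP; rewrite adj_sym => /(lev_adj yS bS).
      by have := fy yS; lia.
    by rewrite !naj // -ck.
  case: (z i) (z j) => [i'|y] [j'|y'] fi fj //=.
  + exact: type_of_adj eqt.
  + exact: mixed.
  + by rewrite adj_sym mixed // adj_sym.
- rewrite eE e'E; case: (z i) => //= i'.
  exact/resp/(type_of_color _ eqt).
- by congr (~~ _); apply: IHf eqt far eE e'E.
- move: rk; rewrite geq_max => /andP[r1 r2].
  by congr (_ && _); [apply: IH1 eqt far eE e'E | apply: IH2 eqt far eE e'E];
    rewrite // => x y /resp[].
case: q => // q in rk lR eqt far *.
have a'lev k : a' k \in S /\ lev (kappa (a' k)) <= l.
  by split=> //; rewrite -(type_of_color _ eqt); case: (aS k).
have half : 2 ^ q.+2 = 2 ^ q.+1 + 2 ^ q.+1 by rewrite [LHS]expnS; lia.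
have key b b' d d' : (forall k, b k \in S /\ lev (kappa (b k)) <= l) ->
    (forall k, b' k \in S /\ lev (kappa (b' k)) <= l) ->
    type_of kappa S q.+1 b = type_of kappa S q.+1 b' ->
    (forall i, d i = pick_value b (z i)) ->
    (forall i, d' i = pick_value b' (z i)) ->
    [exists x, sat f (env_cons x d)] -> [exists x, sat f (env_cons x d')].
  move=> bS b'S eqb dE d'E /existsP[x satx]; apply/existsP.
  (* The gap [2 ^ q.+2] is cut in half: a move in the lower half becomes a pebble and raises [l] by
     [2 ^ q.+1], any other move is copied and [l] is kept. *)
  have [/andP[xS xl]|xfar] :=
    boolP ((x \in S) && (lev (kappa x) <= l + 2 ^ q.+1)); last first.
    exists x; rewrite -(IHf _ q l m b b' (env_cons (inr x) z) (env_cons x d)) //.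
    + lia.
    + by move=> k; case: (b'S k).
    + exact: type_of_pred eqb.
    + move=> i; case: (unliftP ord0 i) => [k|] ->.
        rewrite env_consS; move: (far k); case: (z k) => //= y fy /fy; lia.
      by rewrite env_cons0 /= => xS; move: xfar; rewrite xS /=; lia.
    + by move=> i; case: (unliftP ord0 i) => [k|] ->;
        rewrite ?env_cons0 // !env_consS.
    + by move=> i; case: (unliftP ord0 i) => [k|] ->;
        rewrite ?env_cons0 // !env_consS.
  have [x' x'S eqx] := type_of_forth eqb xS.
  pose up (w : 'I_m + G) : 'I_m.+1 + G :=
    match w with inl k => inl (lift ord0 k) | inr y => inr y end.
  exists x'.
  rewrite -(IHf _ q (l + 2 ^ q.+1) m.+1 (env_cons x b) (env_cons x' b')
    (env_cons (inl ord0) (fun i => up (z i))) (env_cons x d)) //.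
  + lia.
  + move=> j; case: (unliftP ord0 j) => [k|] ->; rewrite ?env_cons0 //.
    by rewrite env_consS; case: (bS k); split=> //; lia.
  + move=> j; case: (unliftP ord0 j) => [k|] ->; rewrite ?env_cons0 //.
    by rewrite env_consS; case: (b'S k).
  + move=> i; case: (unliftP ord0 i) => [k|] ->; rewrite ?env_cons0 //.
    rewrite env_consS; move: (far k); case: (z k) => //= y fy /fy; lia.
  + move=> i; case: (unliftP ord0 i) => [k|] ->; rewrite ?env_cons0 //=.
      by rewrite !env_consS dE; case: (z k) => //= k'; rewrite env_consS.
    by rewrite env_cons0.
  + move=> i; case: (unliftP ord0 i) => [k|] ->; rewrite ?env_cons0 //=.
      by rewrite !env_consS d'E; case: (z k) => //= k'; rewrite env_consS.
    by rewrite env_cons0.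
by apply/idP/idP; [apply: key eqt eE e'E | apply: key (esym eqt) e'E eE].
Qed.

Lemma sat2_local (f : formula U 2) a a' b :
  (forall x y, kappa x = kappa y -> profile_of f x = profile_of f y) ->
  2 ^ (rank f).+1 <= R ->
  a \in S -> a' \in S -> b \notin S -> lev (kappa a) = 0 ->
  type_of kappa S (rank f) (fun _ : 'I_1 => a)
    = type_of kappa S (rank f) (fun _ : 'I_1 => a') ->
  sat2 f a b = sat2 f a' b.
Proof.
move=> resp fR aS a'S bNS a0 eqt.
pose z (i : 'I_2) : 'I_1 + G := if i == ord0 then inl ord0 else inr b.
apply: (sat_local resp (l := 0) (z := z) (leqnn _) _ _ _ eqt) => //.
- by move=> _; rewrite a0.
- by move=> i; rewrite /z; case: eqP => //= _; rewrite (negbTE bNS).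
- by case; case=> [|[]].
- by case; case=> [|[]].
Qed.

End Game.

(** * Separators in graphs of large girth *)

(** An edge walked back and forth is a [ucycle] of size 2, hence the bound [2 < size c]. *)
Definition girth_gt (g : nat) (G : graph) : Prop :=
  forall c : seq G, ucycle (@adj G) c -> 2 < size c -> g < size c.

Definition adj_in (G : graph) (D : {set G}) : rel G :=
  [rel x y | [&& x \in D, y \in D & adj x y]].

Lemma connect_adj_in_sym (G : graph) (D : {set G}) :
  connect_sym (adj_in D).
Proof.
by apply: sym_connect_sym => x y; rewrite /adj_in /= adj_sym andbCA.
Qed.

(** A path in [D] between distinct neighbors of [v] would close up through [v] to a cycle inside
    [F], too short for the girth. *)
Lemma girth_gt_acyclic g (G : graph) (D F : {set G}) v x y :
  girth_gt g G -> #|F| <= g -> D \subset F -> v \in F -> v \notin D ->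
  x \in D -> adj v x -> adj v y -> connect (adj_in D) x y -> x = y.
Proof.
move=> girth leFg DF vF vD xD vx vy /connectP[p0 p0P yE].
move: vy; rewrite {y}yE; case: (shortenP p0P) => p pP up _ vy.
have pD : {subset x :: p <= D}.
  apply/allP; rewrite /= xD /=; elim: p (x) pP {up vy} => //= y p IHp z.
  by case/andP=> /and3P[_ -> _] /IHp.
have pA : path (@adj G) x p by apply: sub_path pP => a b /and3P[].
case: p pP up vy pD pA => //= y p _ up vy pD pA.
suff: g < size [:: v, x, y & p].
  rewrite ltnNge => /negP[]; apply: leq_trans leFg.
  rewrite -(card_uniqP _) /=.
    apply/subset_leq_card/subsetP=> z; rewrite inE => /predU1P[-> //|].
    by move/pD/(subsetP DF).
  rewrite up andbT; apply: contra vD => /pD //.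
apply: girth => //; rewrite /ucycle /= up andbT vx /=.
have -> : v \notin [:: x, y & p] by apply: contra vD => /pD.
by rewrite andbT rcons_path; case/andP: pA => -> -> /=; rewrite adj_sym.
Qed.

Section Separator.
Variables (g : nat) (G : graph) (F : {set G}) (w : G -> nat) (k : nat).
Hypotheses (girthG : girth_gt g G) (leFg : #|F| <= g).
Hypothesis w_le : forall x, w x <= k.

Let wt (D : {set G}) := \sum_(x in D) w x.

(** That is, [A] is a union of connected components of [D] with [v] removed. *)
Definition closed_off (v : G) (D A : {set G}) : bool :=
  [&& A \subset D, v \notin A &
    [forall x in A, forall y in D :\: A, adj x y ==> (y == v)]].

Lemma closed_offP v D A x y : closed_off v D A ->
  x \in A -> y \in D -> y \notin A -> adj x y -> y = v.
Proof.
case/and3P=> _ _ /forall_inP cl xA yD yA xy.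
have /cl/forall_inP/(_ y) := xA.
by rewrite inE yA yD xy => /(_ isT)/eqP.
Qed.

Let branch (v : G) (D : {set G}) : bool :=
  [&& D \subset F, v \in D &
    [forall x in D, forall y in F :\: D, adj x y ==> (x == v)]].

Let branchP v D x y : branch v D ->
  x \in D -> y \in F -> y \notin D -> adj x y -> x = v.
Proof.
case/and3P=> _ _ /forall_inP cl xD yF yD xy.
have /cl/forall_inP/(_ y) := xD.
by rewrite inE yD yF xy => /(_ isT)/eqP.
Qed.

(* Take a minimal [D] of weight above [2/3] attached to the rest of [F] through
   a single [v]: its components after removing [v] are again attached through a
   single vertex, hence weigh at most [2/3], and a heaviest admissible union of
   them weighs about [1/3] at least. *)
Lemma balanced_separator : 0 < wt F ->
  exists v A, [/\ closed_off v F A, 3 * wt A <= 2 * wt F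
                & wt F <= 3 * wt A + 3 * k].
Proof.
move=> F0; set W := wt F in F0 *.
have [v0 v0F] : exists v0, v0 \in F.
  by apply/set0Pn; apply: contraTneq F0 => F0; rewrite /W /wt F0 big_set0.
pose P (p : G * {set G}) := branch p.1 p.2 && (2 * W < 3 * wt p.2).
have P0 : P (v0, F).
  rewrite /P /branch /= subxx v0F /=; apply/andP; split; last by lia.
  by apply/forall_inP=> x _; apply/forall_inP=> y; rewrite setDv inE.
case: (arg_minnP (fun p : G * {set G} => #|p.2|) P0) => -[v D] /andP[/= brD ltD] minD.
have [DF vD _] := and3P brD.
pose Q A := closed_off v D A && (3 * wt A <= 2 * W).
have Q0 : Q set0.
  rewrite /Q /wt big_set0 muln0 leq0n andbT /closed_off sub0set inE /=.
  by apply/forall_inP=> x; rewrite inE.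
case: (arg_maxnP wt Q0) => A /andP[clA leA] maxA.
exists v, A; have [AD vA _] := and3P clA.
have clFA : closed_off v F A.
  rewrite /closed_off vA (subset_trans AD DF) /=.
  apply/forall_inP=> x xA; apply/forall_inP=> y /setDP[yF yA]; apply/implyP=> xy.
  have xD := subsetP AD _ xA.
  have [yD|yD] := boolP (y \in D); first by rewrite (closed_offP clA xA yD yA xy).
  by case/negP: vA; rewrite -(branchP brD xD yF yD xy).
split=> //; rewrite leqNgt; apply/negP=> ltA.
pose D' := D :\ v.
have wtD : wt D = w v + wt D' by rewrite /wt (big_setD1 v).
have AD' : A \subset D' by rewrite subsetD1 AD.
have wtD' : wt D' = wt A + wt (D' :\: A).
  by rewrite /wt (big_setID A) /= (setIidPr AD').
have : 0 < wt (D' :\: A) by have := w_le v; lia.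
rewrite lt0n sum_nat_eq0 => /forall_inPn[x /setDP[xD' xA] wx].
pose C := [set y | connect (adj_in D') x y].
have xC : x \in C by rewrite inE connect0.
have CD' : C \subset D'.
  apply/subsetP=> y; rewrite inE => /connectP[p pP ->].
  elim: p x pP xD' {xA wx C xC} => //= z p IHp x /andP[/and3P[_ zD' _]].
  by move=> /IHp IH _; apply: IH.
have Ccl y z : y \in C -> z \in D' -> adj y z -> z \in C.
  move=> yC zD' yz; move: (yC); rewrite !inE => xy.
  apply: connect_trans xy (connect1 _).
  by rewrite /adj_in /= (subsetP CD' _ yC) zD'.
have vC : v \notin C by apply/negP=> /(subsetP CD'); rewrite !inE eqxx.
have CD : C \subset D by apply: subset_trans CD' (subsetDl _ _).
(* By acyclicity [v] has at most one neighbor [u] in the component [C] (the default [x] serves when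
   there is none), so a heavy [C] would be a branch at [u] smaller than [D]. *)
have ltC : 3 * wt C <= 2 * W.
  rewrite leqNgt; apply/negP=> gtC.
  pose u := odflt x [pick u in C | adj v u].
  have uC : u \in C by rewrite /u; case: pickP => //= u' /andP[].
  have uP y : y \in C -> adj v y -> y = u.
    move=> yC vy; rewrite /u; case: pickP => /= [u' /andP[u'C vu']|/(_ y)];
      last by rewrite yC vy.
    apply: (girth_gt_acyclic girthG leFg _ _ _ (subsetP CD' _ yC) vy vu').
    - exact: subset_trans (subsetDl _ _) DF.
    - exact: subsetP DF _ vD.
    - by rewrite !inE eqxx.
    apply: (@connect_trans _ _ x); last by move: u'C; rewrite inE.
    by rewrite connect_adj_in_sym; move: yC; rewrite inE.
  have : P (u, C).
    rewrite /P /= gtC andbT /branch (subset_trans CD DF) uC /=.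
    apply/forall_inP=> y yC; apply/forall_inP=> z /setDP[zF zC].
    apply/implyP=> yz.
    have [zD|zD] := boolP (z \in D).
      have [zv|zv] := eqVneq z v; first by rewrite (uP y) // -zv adj_sym.
      by case/negP: zC; apply: (Ccl y) => //; rewrite !inE zv.
    by case/negP: vC; rewrite -(branchP brD (subsetP CD _ yC) zF zD yz).
  move/minD; rewrite /= leqNgt => /negP[]; apply: proper_card.
  by apply/properP; split=> //; exists v.
have Cclosed (B : {set G}) : B \subset D' ->
    (forall y z, y \in B -> z \in D' -> adj y z -> z \in B) -> closed_off v D B.
  move=> BD' cB; rewrite /closed_off (subset_trans BD') ?subsetDl //=.
  rewrite (contra (subsetP BD' v)) ?inE ?eqxx //=.
  apply/forall_inP=> y yB; apply/forall_inP=> z /setDP[zD zB]; apply/implyP=> yz.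
  by apply: contraR zB => zv; apply: (cB y) => //; rewrite !inE zv.
(* [C] alone is admissible, so it weighs at most [wt A], which is below a third of [W]. Hence
   [A :|: C] is admissible too, and it is strictly heavier than [A]. *)
have leCA : wt C <= wt A by apply/maxA; rewrite /Q ltC andbT Cclosed.
have Acl y z : y \in A -> z \in D' -> adj y z -> z \in A.
  move=> yA; rewrite !inE => /andP[zv zD] yz; apply: contraR zv => zA.
  by rewrite (closed_offP clA yA zD zA yz).
have dAC : [disjoint A & C].
  apply/pred0P=> y /=; apply/negP=> /andP[yA yC]; case/negP: xA.
  have yx : connect (adj_in D') y x.
    by rewrite connect_adj_in_sym; move: yC; rewrite inE.
  case/connectP: yx => p pP ->; elim: p y pP yA {yC} => //= z p IHp y.
  by case/andP=> /and3P[_ zD yz] pP yA; apply: IHp pP (Acl _ _ yA zD yz).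
have wtU : wt (A :|: C) = wt A + wt C.
  transitivity (\sum_(y in [predU A & C]) w y); last exact: bigU.
  by apply: eq_bigl => y; rewrite inE.
have /maxA : Q (A :|: C).
  apply/andP; split; last by move: leA ltA ltC leCA wtU; clear; lia.
  apply: Cclosed; first by rewrite subUset AD'.
  move=> y z /setUP[yA|yC] zD' yz; apply/setUP; first by left; apply: Acl yz.
  by right; apply: Ccl yz.
suff: 0 < wt C by move: wtU; clear=> /=; lia.
by rewrite /wt (bigD1 x) //= ltn_addr // lt0n.
Qed.

End Separator.

(** * Regular graphs of large girth *)

Section Cayley.
Variables (d g : nat).
Local Open Scope group_scope.

Definition neq_rel : rel 'I_d := fun i j => i != j.

Definition reduced (s : seq 'I_d) : bool := sorted neq_rel s.

(* Reduced words of length at most [g + 1] in [d] involutive letters, that is, a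
   ball of the [d]-regular tree.  Letter [i] acts by adding or cancelling a
   leading [i], and the permutations so obtained satisfy no relation of length
   at most [g + 1]. *)
Definition ball : finType := {s : (g.+1).-bseq 'I_d | reduced s}.

(** On a word of maximal length not starting with [i] the letter acts trivially, so that [step i]
    stays an involution of the ball. *)
Definition step (i : 'I_d) (s : seq 'I_d) : seq 'I_d :=
  if s is j :: s' then
    if j == i then s' else if size s <= g then i :: s else s
  else [:: i].

Definition word (t : ball) : seq 'I_d := val t.

Lemma word_inj : injective word.
Proof. by move=> s t /val_inj/val_inj. Qed.

Lemma wordP (t : ball) : reduced (word t) /\ size (word t) <= g.+1.
Proof. by split; [apply: (valP t) | apply: size_bseq]. Qed.

Lemma ball_of (s : seq 'I_d) : reduced s -> size s <= g.+1 ->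
  {t : ball | word t = s}.
Proof. by move=> rs sg; exists (exist _ (Bseq sg) rs). Qed.

Lemma step_ball i s : reduced s -> size s <= g.+1 ->
  reduced (step i s) /\ size (step i s) <= g.+1.
Proof.
rewrite /step; case: s => [|j s] //= rs sg.
have [_|ji] := eqVneq j i.
  by split; [apply: path_sorted rs | apply: ltnW].
by case: ifP => //= lt; rewrite /neq_rel eq_sym ji.
Qed.

Lemma step_invol i s : reduced s -> size s <= g.+1 -> step i (step i s) = s.
Proof.
rewrite {2}/step; case: s => [|j s] /= rs sg; first by rewrite eqxx.
have [ji|ji] := eqVneq j i.
  subst j; rewrite /step; case: s rs sg => //= l s /andP[il _] sg.
  by rewrite eq_sym (negbTE il) ltnS in sg *; rewrite sg.
by case: ifP => /= lt; rewrite ?eqxx // (negbTE ji) lt.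
Qed.

Definition act (i : 'I_d) (t : ball) : ball :=
  let: conj rt st := wordP t in
  let: conj r s := step_ball i rt st in sval (ball_of r s).

Lemma word_act i t : word (act i t) = step i (word t).
Proof.
rewrite /act; case: (wordP t) => rt st; case: (step_ball i rt st) => r s.
by case: (ball_of r s).
Qed.

Lemma act_invol i : involutive (act i).
Proof.
move=> t; apply: word_inj; rewrite !word_act.
by case: (wordP t) => ? ?; apply: step_invol.
Qed.

Definition gen (i : 'I_d) : {perm ball} := perm (inv_inj (act_invol i)).

Lemma gen_invol i : gen i * gen i = 1.
Proof. by apply/permP=> t; rewrite permM !permE /= act_invol. Qed.

(** A product of permutations applies its first factor first, so the letters are prepended in turn
    and come out reversed; the length bound rules out truncation by [step]. *)
Lemma gen_word (s : seq 'I_d) (t : ball) :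
  reduced (catrev s (word t)) -> size s + size (word t) <= g.+1 ->
  word ((\prod_(i <- s) gen i) t) = catrev s (word t).
Proof.
elim: s t => [|i s IHs] t /=; first by rewrite big_nil perm1.
rewrite big_cons permM permE => rs sg.
have wt : word (act i t) = i :: word t.
  rewrite word_act; have: reduced (i :: word t).
    by move: rs; rewrite /reduced catrevE => /cat_sorted2[].
  case: (word t) sg => [|j w] //= sg /andP[ij _].
  by rewrite eq_sym (negbTE ij) (_ : size w < g) //; lia.
by rewrite IHs wt //=; lia.
Qed.

Lemma reduced_prod_neq1 (s : seq 'I_d) :
  reduced s -> 0 < size s <= g.+1 -> \prod_(i <- s) gen i != 1.
Proof.
move=> rs /andP[s0 sg]; apply/eqP=> s1.
have [t t0] := ball_of (s := [::]) isT isT.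
have rr : reduced (catrev s (word t)).
  rewrite t0 -/(rev s) /reduced rev_sorted.
  by rewrite (eq_sorted (e' := neq_rel)) // => i j; rewrite /neq_rel eq_sym.
have := gen_word rr; rewrite s1 perm1 t0 addn0 => /(_ sg)/(congr1 size).
by rewrite /= -/(rev s) size_rev; lia.
Qed.

Lemma gen_inj : injective gen.
Proof.
move=> i j eqij; have [t t0] := ball_of (s := [::]) isT isT.
have := congr1 (fun p : {perm ball} => word (p t)) eqij.
by rewrite !permE !word_act t0 => -[].
Qed.

Definition cayley_adj : rel {perm ball} := fun x y => [exists i, y == x * gen i].

Lemma cayley_adj_sym : symmetric cayley_adj.
Proof.
suff sub x y : cayley_adj x y -> cayley_adj y x by move=> x y; apply/idP/idP; apply: sub.
case/existsP=> i /eqP ->; apply/existsP; exists i.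
by rewrite -mulgA gen_invol mulg1.
Qed.

Lemma cayley_adj_irrefl : irreflexive cayley_adj.
Proof.
move=> x; apply/negbTE/existsPn=> i.
rewrite eq_sym -{2}[x]mulg1 (inj_eq (mulgI x)).
by have := @reduced_prod_neq1 [:: i] isT isT; rewrite big_seq1.
Qed.

Definition cayley : graph := Graph cayley_adj_sym cayley_adj_irrefl.

Lemma cayley_degree (x : cayley) : degree x = d.
Proof.
rewrite /degree -[RHS](card_ord d) -(card_imset predT (f := fun i => x * gen i)).
  apply: eq_card => y; rewrite inE; apply/existsP/imsetP=> [[i /eqP ->]|[i _ ->]].
    by exists i.
  by exists i; apply/eqP.
by move=> i j /mulgI/gen_inj.
Qed.

Fixpoint nonbacktracking (T : eqType) (s : seq T) : bool :=
  if s is x :: (y :: s') as t then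
    (if s' is z :: _ then x != z else true) && nonbacktracking t
  else true.

Lemma uniq_nonbacktracking (T : eqType) (s : seq T) :
  uniq s -> nonbacktracking s.
Proof.
elim: s => [|x [|y s] IHs] //= /andP[xNs /IHs/=->]; rewrite andbT.
by case: s xNs {IHs} => //= z s; rewrite !inE !negb_or => /and3P[].
Qed.

(** The clause on [head x p] identifies the first letter of the walk; in the induction it turns
    distinctness of vertices two steps apart into distinctness of consecutive letters. *)
Lemma walk_word (x : cayley) (p : seq cayley) :
  path (@adj cayley) x p -> nonbacktracking (x :: p) ->
  exists s, [/\ size s = size p, last x p = x * \prod_(i <- s) gen i,
    reduced s & head x p = x * \prod_(i <- take 1 s) gen i].
Proof.
elim: p x => [|y p IHp] x.
  by exists [::]; rewrite /= big_nil mulg1.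
case/andP=> /existsP[i /eqP yE] pP /andP[nb nbp].
have [s [ss sl rs sh]] := IHp y pP nbp.
exists (i :: s); split=> //=; first by rewrite ss.
- by rewrite sl big_cons mulgA yE.
- case: s rs sh ss {sl} => //= j s -> sh ss; rewrite andbT.
  case: p nb sh ss {IHp pP nbp} => //= z p xz; rewrite take0 big_seq1 => zE _.
  apply: contra xz => /eqP ij.
  by rewrite zE yE ij -mulgA gen_invol mulg1.
- by rewrite take0 big_seq1.
Qed.

(** The generators along a cycle of size at most [g] form a nonempty reduced word with product 1,
    against [reduced_prod_neq1]. *)
Lemma cayley_girth : girth_gt g cayley.
Proof.
case=> [|x [|y p]] // /andP[cP uc] sc; rewrite ltnNge; apply/negP=> le.
have nb : nonbacktracking [:: x, y & rcons p x].
  have : uniq (y :: rcons p x).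
    by rewrite -rcons_cons rcons_uniq; move: uc; rewrite /= => /and3P[-> -> ->].
  move/uniq_nonbacktracking=> /= ->; rewrite andbT.
  case: p sc uc {cP le} => //= z p _; rewrite !inE !negb_or.
  by case/and3P=> /and3P[].
have [s [ss + rs _]] := walk_word cP nb.
rewrite last_rcons -[X in X = _]mulg1 => /mulgI/esym/eqP; apply/negP.
apply: reduced_prod_neq1 rs _; rewrite ss /= size_rcons; move: le => /=; lia.
Qed.

End Cayley.

(** * Twin-width *)

Lemma reducible_inv d (H : trigraph) : reducible d H ->
  max_red_degree H <= d /\
  (#|H| <= 1 \/ exists u v : H, u != v /\ reducible d (contract u v)).
Proof.
case=> {}H; first by move=> ? ?; split=> //; left.
by move=> u v ? ? ?; split=> //; right; exists u, v.
Qed.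

Lemma girth_common_neighbors (G : graph) (u v : G) : girth_gt 4 G -> u != v ->
  #|[set y | adj u y] :&: [set y | adj v y]| <= 1.
Proof.
move=> girth uv; rewrite leqNgt; apply/negP=> /card_gt1P[x [y []]].
rewrite !inE => /andP[ux vx] /andP[uy vy] xy.
suff : 4 < size [:: u; x; v; y] by [].
have neq (a b : G) : adj a b -> a != b.
  by apply: contraTneq => ->; rewrite adj_irrefl.
apply: girth => //.
rewrite /ucycle /= !inE ux adj_sym vx vy adj_sym uy !negb_or uv xy !neq //.
by rewrite adj_sym.
Qed.

Lemma twin_width_ge d (G : graph) : girth_gt 4 G -> 1 < #|G| ->
  (forall x : G, degree x = d) -> d - 2 <= twin_width G.
Proof.
move=> girth G1 deg; rewrite /twin_width; case: ex_minnP => t /asboolP + _.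
case/reducible_inv=> _ [|[/= u [/= v [uv /reducible_inv[+ _]]]]]; first by rewrite leqNgt G1.
apply: leq_trans.
pose u' : contract (H := black_trigraph G) u v := exist _ u uv.
apply: leq_trans (leq_bigmax u').
rewrite /red_degree -(card_imset _ val_inj).
(* These vertices become red neighbors of the contracted vertex. Of the [d] neighbors of [u], at
   most one is shared with [v] and at most one is [v] itself. *)
have sub : ([set y | adj u y] :\: [set y | adj v y]) :\ v \subset
    [set val y | y in [set y | red u' y]].
  apply/subsetP=> y; rewrite !inE => /and3P[yv vy uy].
  apply/imsetP; exists (exist _ y yv) => //.
  rewrite inE /red /= /contract_adj /contract_black /= uy eqxx (negbTE vy).
  rewrite /= ?andbT.
  by apply: contraTneq uy => ->; rewrite adj_irrefl.
apply: leq_trans (subset_leq_card sub).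
have := girth_common_neighbors girth uv; have := deg u.
have := cardsID [set y | adj v y] [set y | adj u y].
have := cardsD1 v ([set y | adj u y] :\: [set y | adj v y]).
by rewrite /degree; lia.
Qed.

(** * Expanded cliques *)

Section BlownUpClique.
Variables (N m : nat).

(* The vertices [(i, j)] with [i] fixed form a path replacing the vertex [i] of
   the clique; the edge [ij] of the clique becomes [(i, j) -- (j, i)]. *)
Definition rail_adj : rel ('I_N * 'I_N) := fun p q =>
  ((p.1 == q.1) && ((p.2.+1 == q.2 :> nat) || (q.2.+1 == p.2 :> nat)))
  || [&& p.1 == q.2, p.2 == q.1 & p != q].

Lemma rail_adj_sym : symmetric rail_adj.
Proof.
move=> p q; rewrite /rail_adj (eq_sym p.1 q.1) (eq_sym q p).
rewrite (andbCA (q.1 == _)) (eq_sym q.2 p.1) (eq_sym q.1 p.2).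
by congr (_ && _ || _); rewrite orbC.
Qed.

Lemma rail_adj_irrefl : irreflexive rail_adj.
Proof.
move=> p; rewrite /rail_adj !eqxx /= !andbF orbF.
by apply/negP=> /orP[] /eqP; lia.
Qed.

Lemma rail_degree (p : 'I_N * 'I_N) : #|[set q | rail_adj p q]| <= 3.
Proof.
(* At an end of the path the missing neighbor defaults to [p] itself, which is harmless for an upper
   bound. *)
pose s : seq ('I_N * 'I_N) := [:: (p.1, insubd p.2 p.2.+1);
  (p.1, insubd p.2 p.2.-1); (p.2, p.1)].
apply: (@leq_trans #|[set q in s]|); last first.
  by rewrite cardsE; apply: card_size.
apply/subset_leq_card/subsetP=> -[i j]; rewrite !inE /rail_adj /=.
case/orP=> [/andP[/eqP<- /orP[]/eqP e]|/and3P[/eqP<- /eqP<-]]; last by rewrite eqxx !orbT.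
  suff -> : j = insubd p.2 p.2.+1 by rewrite eqxx.
  by apply: val_inj; rewrite val_insubd e ltn_ord.
suff -> : j = insubd p.2 p.2.-1 by rewrite eqxx orbT.
by apply: val_inj; rewrite val_insubd -e /= ltn_ord.
Qed.

Definition blowup_adj : rel ('I_N * 'I_N + 'I_m) := fun x y =>
  match x, y with inl p, inl q => rail_adj p q | _, _ => false end.

Lemma blowup_adj_sym : symmetric blowup_adj.
Proof. by case=> [p|i] [q|j] //=; apply: rail_adj_sym. Qed.

Lemma blowup_adj_irrefl : irreflexive blowup_adj.
Proof. by case=> [p|i] //=; apply: rail_adj_irrefl. Qed.

Definition blowup : graph := Graph blowup_adj_sym blowup_adj_irrefl.

Lemma blowup_subcubic : subcubic blowup.
Proof.
case=> [p|i]; rewrite /degree.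
  apply: leq_trans (rail_degree p); rewrite -(card_imset [set q | rail_adj p q] (@inl_inj _ 'I_m)).
  apply/subset_leq_card/subsetP=> -[q|j]; rewrite inE //= => pq.
  by apply: imset_f; rewrite inE.
by rewrite (_ : [set y | _] = set0) ?cards0 //; apply/setP=> -[q|j]; rewrite !inE.
Qed.

Lemma rail_cut (C : finType) (A : {set 'I_N * 'I_N}) (c : 'I_N * 'I_N -> C) k :
  (forall p p' b, p \in A -> p' \in A -> b \notin A -> c p = c p' ->
     rail_adj p b = rail_adj p' b) ->
  3 * #|A| <= 2 * N ^ 2 -> N ^ 2 <= 3 * #|A| + 3 * k ->
  N <= 18 * #|C| + 3 * k.
Proof.
move=> cP leA geA.
pose B := [set b | (b \notin A) && [exists p in A, rail_adj p b]].
(* The neighbors of one representative per value of [c] already cover [B]. *)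
have leB : #|B| <= 3 * #|C|.
  pose nb t := if [pick p in A | c p == t] is Some p
    then [set b | rail_adj p b] else set0.
  apply: (@leq_trans #|\bigcup_t nb t|).
    apply/subset_leq_card/subsetP=> b; rewrite inE => /andP[bA /exists_inP[p pA pb]].
    apply/bigcupP; exists (c p) => //; rewrite /nb.
    case: pickP => [p' /andP[p'A /eqP e]|/(_ p)]; last by rewrite pA eqxx.
    by rewrite inE (cP p' p).
  apply: (@leq_trans (\sum_(t : C) #|nb t|)).
    elim/big_rec2: _ => [|t n X _ le]; first by rewrite cards0.
    by apply: leq_trans (leq_card_setU _ _) _; rewrite leq_add2l.
  apply: (@leq_trans (\sum_(t : C) 3)); last by rewrite sum_nat_const mulnC.
  apply: leq_sum => t _; rewrite /nb; case: pickP => [p _|_]; last by rewrite cards0.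
  exact: rail_degree.
pose P := [set i | [forall j, (i, j) \in A]].
pose Q := [set i | [forall j, (i, j) \notin A]].
have leM : #|~: (P :|: Q)| <= #|B|.
  apply: (@leq_trans #|[set b.1 | b in B]|); last exact: leq_imset_card.
  apply/subset_leq_card/subsetP=> i; rewrite !inE negb_or.
  case/andP=> /forallPn[j jA] /forallPn[j']; rewrite negbK => j'A.
  pose r n := (i, insubd j n) \in A.
  have rE (l : 'I_N) : r l = ((i, l) \in A).
    by rewrite /r; congr ((i, _) \in A); apply: val_inj; rewrite val_insubd ltn_ord.
  have step n n' : n < N -> n' < N -> (n.+1 == n') || (n'.+1 == n) ->
      r n -> ~~ r n' -> i \in [set b.1 | b in B].
    move=> nN n'N nn' rn rn'; apply/imsetP; exists (i, insubd j n') => //.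
    rewrite inE rn' /=; apply/exists_inP; exists (i, insubd j n) => //.
    by rewrite /rail_adj /= eqxx !val_insubd nN n'N nn'.
  (* Between a position in [A] and one outside, membership flips at two consecutive positions, and
     the one outside [A] belongs to [B]. *)
  have mono n n' : n <= n' -> n' < N -> (r n && ~~ r n') || (~~ r n && r n') ->
      i \in [set b.1 | b in B].
    elim: n' => [|n' IH]; first by rewrite leqn0 => /eqP-> _; case: (r 0).
    rewrite leq_eqVlt => /predU1P[->|]; first by case: (r _).
    rewrite ltnS => nn' n'N; have n'N' := ltnW n'N.
    case rn' : (r n'); case rn1 : (r n'.+1); rewrite ?andbT ?andbF ?orbF /=.
    + by move=> rn; apply: IH => //; rewrite rn' rn orbT.
    + by move=> _; apply: (step n' n'.+1); rewrite ?eqxx ?rn' ?rn1.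
    + by move=> _; apply: (step n'.+1 n'); rewrite ?eqxx ?orbT ?rn' ?rn1.
    + by move=> rn; apply: IH => //; rewrite rn' rn.
  have [le|le] := leqP j j'.
    by apply: (mono j j') => //; rewrite !rE jA j'A orbT.
  by apply: (mono j' j) => //; rewrite ?(ltnW le) // !rE jA j'A.
have PQ : #|P :|: Q| + #|~: (P :|: Q)| = N.
  by rewrite cardsC card_ord.
have cols (X : {set 'I_N}) (Y : {set 'I_N * 'I_N}) :
    (forall p, p \in Y -> p.1 \in X) -> #|Y| <= #|X| * N.
  move=> XY; rewrite -[X in _ * X]card_ord -cardsT -cardsX.
  by apply/subset_leq_card/subsetP=> -[i j] /XY; rewrite !inE /= andbT.
have leAP : #|A| <= (#|P| + #|~: (P :|: Q)|) * N.
  apply: leq_trans (leq_mul (leq_card_setU _ _) (leqnn N)); apply: cols.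
  move=> [i j] ijA; rewrite !inE /=; case: forallP => //= _.
  by apply/forallPn; exists j; rewrite negbK.
have leAQ : #|~: A| <= (#|Q| + #|~: (P :|: Q)|) * N.
  apply: leq_trans (leq_mul (leq_card_setU _ _) (leqnn N)); apply: cols.
  move=> [i j]; rewrite inE => ijA; rewrite !inE /= orbC negb_or andbC.
  by case: [forall j, (i, j) \notin A] => //=; rewrite orbF; apply/forallPn; exists j.
have AC : #|A| + #|~: A| = N ^ 2.
  by rewrite cardsC card_prod card_ord expnS expn1.
(* If no path lies inside [A], then [A] is covered by the paths that meet both sides, too few for
   its weight unless [N] is small. *)
have [P0|] := posnP #|P|.
  move: leAP; rewrite P0 add0n => leAP.
  have : #|A| <= 3 * #|C| * N.
    by apply: leq_trans leAP _; rewrite leq_mul2r (leq_trans leM leB) orbT.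
  by move: geA; rewrite expnS expn1; clear; nia.
rewrite card_gt0 => /set0Pn[i]; rewrite inE => /forallP iP.
(* The path [i] inside [A] is joined to every path [j] outside [A], which puts [(j, i)] in [B]. *)
have leQ : #|Q| <= #|B|.
  have inj : injective (fun j : 'I_N => (j, i)) by move=> j j' [].
  rewrite -(card_imset Q inj); apply/subset_leq_card/subsetP=> _ /imsetP[j + ->].
  rewrite !inE => /forallP jQ; rewrite jQ /=; apply/exists_inP; exists (i, j) => //.
  rewrite /rail_adj /= !eqxx /=; apply/orP; right.
  by apply: contraTneq (iP j) => -[-> _]; apply: jQ.
(* Since the complement of [A] has at least a third of all [N ^ 2] vertices, this gives the constant
   18. *)
have : #|~: A| <= 6 * #|C| * N.
  apply: leq_trans leAQ _; rewrite leq_mul2r; apply/orP; right; lia.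
by move: leA AC; rewrite expnS expn1; clear; nia.
Qed.

End BlownUpClique.

(** * The counterexample *)

Section Neighborhood.
Variables (G : graph) (X : {set G}).

Fixpoint nbhd (i : nat) : {set G} :=
  if i is i'.+1 then nbhd i' :|: [set y | [exists x in nbhd i', adj x y]] else X.

Lemma nbhd_adj i x y : x \in nbhd i -> adj x y -> y \in nbhd i.+1.
Proof.
by move=> xi xy; rewrite !inE; apply/orP; right; apply/exists_inP; exists x.
Qed.

Lemma nbhd_sub i j : i <= j -> nbhd i \subset nbhd j.
Proof.
move/subnK<-; elim: (j - i) => // n /subset_trans; apply.
exact: subsetUl.
Qed.

Lemma nbhd_card d i : (forall x : G, degree x <= d) ->
  #|nbhd i| <= #|X| * d.+1 ^ i.
Proof.
move=> deg; elim: i => [|i IHi]; first by rewrite muln1.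
apply: (@leq_trans (#|nbhd i| * d.+1)); last first.
  by rewrite expnSr mulnA leq_mul2r IHi orbT.
rewrite -sum_nat_const.
apply: (@leq_trans #|\bigcup_(x in nbhd i) (x |: [set y | adj x y])|).
  apply/subset_leq_card/subsetP=> y; case/setUP=> [yi|].
    by apply/bigcupP; exists y; rewrite ?setU11.
  rewrite inE => /exists_inP[x xi xy].
  by apply/bigcupP; exists x; rewrite // !inE xy orbT.
apply: (@leq_trans (\sum_(x in nbhd i) #|x |: [set y | adj x y]|)).
  elim/big_rec2: _ => [|x n Y _ le]; first by rewrite cards0.
  by apply: leq_trans (leq_card_setU _ _) _; rewrite leq_add2l.
apply: leq_sum => x _; rewrite cardsU1; apply: (@leq_add _ _ 1 d).
  by case: (_ \notin _).
exact: deg.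
Qed.

Variable R : nat.

(** The distance from [X], capped at [R], because [find] returns the length of the list on
    failure. *)
Definition level (x : G) : nat := find (fun i => x \in nbhd i) (iota 0 R).

Lemma level_le x : level x <= R.
Proof. by rewrite -[leqRHS](size_iota 0); apply: find_size. Qed.

Lemma level_leP x i : i < R -> x \in nbhd i -> level x <= i.
Proof.
move=> iR xi; rewrite leqNgt; apply/negP=> /(before_find 0).
by rewrite nth_iota // xi.
Qed.

Lemma level_nbhd x : level x < R -> x \in nbhd (level x).
Proof.
move=> lR; have := lR; rewrite -{1}(size_iota 0 R) -has_find => /(nth_find 0).
by rewrite nth_iota.
Qed.

Lemma level_adj x y : adj x y -> level y <= (level x).+1.
Proof.
move=> xy; have [lt|ge] := ltnP (level x).+1 R.
  by apply: level_leP lt (nbhd_adj (level_nbhd (ltnW lt)) xy).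
exact: leq_trans (level_le y) ge.
Qed.

End Neighborhood.

Lemma sum_card_fibers (P T : finType) (phi : P -> T) (D : {set T}) :
  \sum_(x in D) #|[set p | phi p == x]| = #|[set p | phi p \in D]|.
Proof.
rewrite -sum1_card (partition_big phi (mem D)) /=; last by move=> p; rewrite inE.
apply: eq_bigr => x xD; rewrite -sum1_card; apply: eq_bigl => p.
by rewrite !inE; case: eqP => [->|]; rewrite ?xD ?andbF.
Qed.

Section Cut.
Variables (U : Type) (k : nat) (f : formula U 2).

Definition radius : nat := 2 ^ (rank f).+1.

(** The three components are what [sat2_local] needs to read off a color: the profile, the capped
    distance, and the adjacency to the [k] copies of the separating vertex. *)
Definition cut_color : finType :=
  (profile f * 'I_radius.+1 * {ffun 'I_k -> bool})%type.

Definition cut_type : finType := fo_type cut_color (rank f) 1.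

Lemma local_cut (G : graph) (col : U -> {set copy k G}) d g (P : finType)
    (h : P -> copy k G) :
  injective h -> (forall x : G, degree x <= d) -> girth_gt g G ->
  #|P| * d.+1 ^ radius <= g -> 0 < #|P| ->
  exists (A : {set P}) (c : P -> cut_type),
    [/\ 3 * #|A| <= 2 * #|P|, #|P| <= 3 * #|A| + 3 * k &
      forall p p' b, p \in A -> p' \in A -> b \notin A -> c p = c p' ->
        sat2 (G := ColoredGraph col) f (h p) (h b)
          = sat2 (G := ColoredGraph col) f (h p') (h b)].
Proof.
move=> h_inj deg girth leg P0.
pose phi p := (h p).1; pose w x := #|[set p | phi p == x]|.
have w_le x : w x <= k.
  have inj : {in [set p | phi p == x] &, injective (fun p => (h p).2)}.
    move=> p p'; rewrite !inE => /eqP px /eqP p'x e; apply: h_inj.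
    by rewrite [LHS]surjective_pairing [RHS]surjective_pairing e -!/(phi _) px p'x.
  by rewrite /w -(card_in_imset inj) -[leqRHS](card_ord k); apply: max_card.
pose X := [set phi p | p : P]; pose F := nbhd X radius.
have XF p : phi p \in F.
  by apply: subsetP (nbhd_sub X (leq0n radius)) _ _; apply: imset_f.
have leF : #|F| <= g.
  apply: leq_trans leg; apply: leq_trans (nbhd_card _ _ deg) _.
  by rewrite leq_mul2r leq_imset_card orbT.
have wF : \sum_(x in F) w x = #|P|.
  by rewrite sum_card_fibers; apply: eq_card => p; rewrite inE XF.
have [|v [A0 [clA0]]] := balanced_separator girth leF w_le; first by rewrite wF.
rewrite wF sum_card_fibers => leA geA.
pose kappa (x : copy k G) : cut_color :=
  (profile_of (G := ColoredGraph col) f x, inord (level X radius x.1),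
   [ffun i => adj x ((v, i) : copy k G)]).
pose lev (c : cut_color) : nat := c.1.2.
have levE x : lev (kappa x) = level X radius x.1.
  by rewrite /lev /= inordK // ltnS level_le.
pose S := [set y : copy k G | y.1 \in A0].
exists [set p | phi p \in A0],
  (fun p => type_of kappa S (rank f) (fun _ : 'I_1 => h p)).
split=> // p p' b; rewrite !inE => pA p'A bA.
apply: (@sat2_local _ (ColoredGraph col) _ kappa S lev radius); rewrite ?inE //.
- move=> x y _ _; rewrite !levE => /orP[/andP[_ xy]|/andP[/eqP-> _]] //.
  by apply: level_adj; rewrite adj_sym.
- move=> x x' y; rewrite !inE => xA x'A yA xx' lt.
  have [yv|yv] := eqVneq y.1 v.
    have [_ _ /ffunP/(_ y.2)] := xx'; rewrite !ffunE -yv.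
    by rewrite -surjective_pairing.
  (* A neighbor of [z] in the same copy still lies over [F], so leaving [A0] would force it to lie
     over [v]; a neighbor in another copy lies over the same vertex of [A0]. *)
  have far (z : copy k G) : z.1 \in A0 -> lev (kappa z) < radius -> adj z y = false.
    move=> zA; rewrite levE => ltz; apply/negbTE/negP=> /orP[/andP[_ zy]|].
      case/eqP: yv; apply: (closed_offP clA0 zA _ yA zy).
      by apply: subsetP (nbhd_sub X ltz) _ (nbhd_adj (level_nbhd ltz) zy).
    by case/andP=> /eqP zy _; rewrite -zy zA in yA.
  by rewrite !far // -xx'.
- by move=> x y [].
- rewrite levE; apply/eqP; rewrite -leqn0; apply: level_leP.
    by rewrite expn_gt0.
  exact: imset_f.
Qed.

End Cut.

Lemma iso_degree (G H : graph) d : graph_iso G H ->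
  (forall x : G, degree x = d) -> forall y : H, degree y = d.
Proof.
case=> f [f' fK f'K] fE deg y; rewrite -(deg (f' y)) /degree.
rewrite -(card_imset _ (can_inj f'K)); apply: eq_card => x.
rewrite inE; apply/imsetP/idP => [[z + ->]|xy].
  by rewrite inE -fE !f'K.
by exists (f x); rewrite ?fK // inE -(f'K y) fE.
Qed.

Lemma iso_girth (G H : graph) g : graph_iso G H -> girth_gt g G -> girth_gt g H.
Proof.
case=> f [f' fK f'K] fE girth c /andP[cP cu] c2; rewrite -(size_map f').
apply: girth; last by rewrite size_map.
rewrite /ucycle map_inj_uniq ?cu ?andbT; last exact: can_inj f'K.
by rewrite cycle_map (eq_cycle (e' := @adj H)) // => x y /=; rewrite -fE !f'K.
Qed.

Lemma iso_card (G H : graph) : graph_iso G H -> #|G| = #|H|.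
Proof. by case=> f /bij_eq_card. Qed.

Lemma graph_iso_refl (G : graph) : graph_iso G G.
Proof. by exists id => //; exists id. Qed.

Lemma graph_iso_trans (G H K : graph) :
  graph_iso G H -> graph_iso H K -> graph_iso G K.
Proof.
case=> f fb fE [f' fb' fE']; exists (f' \o f); first exact: bij_comp.
by move=> x y /=; rewrite fE' fE.
Qed.

(** The girth bound dominates the size of the ball of radius at most [j] around at most [j] vertices
    in a [j]-regular graph. *)
Definition high_girth_graph (j : nat) : graph := cayley j (j * j.+1 ^ j).

Lemma high_girth_iso (G H : graph) : graph_iso G H ->
  #|G| = 0 \/ (exists j, graph_iso (high_girth_graph j) G) ->
  #|H| = 0 \/ (exists j, graph_iso (high_girth_graph j) H).
Proof.
move=> GH [G0|[j jG]]; first by left; rewrite -(iso_card GH).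
by right; exists j; apply: graph_iso_trans GH.
Qed.

Definition high_girth : graph_class :=
  @GraphClass (fun G => #|G| = 0 \/ exists j, graph_iso (high_girth_graph j) G)
    high_girth_iso (fun G G0 => or_introl G0).

Lemma high_girth_unbounded : unbounded_twin_width high_girth.
Proof.
case=> t tP; pose j := t.+3; pose G := high_girth_graph j.
have deg (x : G) : degree x = j by apply: cayley_degree.
have : twin_width G <= t by apply: tP; right; exists j; apply: graph_iso_refl.
apply/negP; rewrite -ltnNge; apply: (@leq_trans (j - 2)); first by rewrite /j; lia.
apply: (twin_width_ge _ _ deg).
  move=> c cc c2; apply: leq_ltn_trans (cayley_girth cc c2).
  have : j.+1 <= j.+1 ^ j by rewrite -{1}(expn1 j.+1) leq_exp2l.
  by rewrite {1}/j /j; nia.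
have : 0 < degree (1%g : G) by rewrite deg.
case/card_gt0P=> y; rewrite inE => xy.
apply/card_gt1P; exists 1%g, y; split=> //.
by apply: contraTneq xy => <-; rewrite adj_irrefl.
Qed.

Lemma subcubic_not_transduced : ~ transduction_of subcubic_graphs high_girth.
Proof.
case=> T TP; set k := copies T; set f := eta (interp T).
(* One more than the bound of [rail_cut] allows. *)
pose N := 18 * #|cut_type k f| + 3 * k + 1.
pose J := maxn (N ^ 2) (radius f).
(* More isolated vertices than [k] copies of any [high_girth_graph j] with [j < J] have vertices,
   which forces [J <= j]. *)
pose m := (\sum_(j < J) #|high_girth_graph j| * k).+1.
have [G DG [col isoH]] := TP _ (@blowup_subcubic N m).
have cardH : #|blowup N m| = N ^ 2 + m.
  by rewrite card_sum card_prod !card_ord expnS expn1.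
have leH : #|blowup N m| <= #|G| * k.
  rewrite -(iso_card isoH) [leqLHS]card_sig -[in leqRHS](card_ord k) -card_prod.
  exact: max_card.
case: DG => [G0|[j isoG]]; first by move: leH; rewrite cardH G0; lia.
have [ltjJ|leJj] := ltnP j J.
  move: leH; rewrite cardH -(iso_card isoG) /m (bigD1 (Ordinal ltjJ)) //=; lia.
case: isoH => [e [e' eK e'K] eE].
pose h (p : 'I_N * 'I_N) : copy k G := val (e' (inl p)).
have h_inj : injective h.
  by move=> p q /val_inj/(can_inj e'K) [].
have cardP : #|{: 'I_N * 'I_N}| = N ^ 2 by rewrite card_prod card_ord expnS expn1.
have [||||A [c [leA geA cP]]] := @local_cut _ k f G col j (j * j.+1 ^ j) _ h h_inj.
- by move=> x; rewrite (iso_degree isoG (@cayley_degree _ _)).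
- exact: iso_girth isoG (@cayley_girth _ _).
- rewrite cardP leq_mul ?leq_pexp2l //.
    exact: leq_trans (leq_maxl _ _) leJj.
  exact: leq_trans (leq_maxr _ _) leJj.
- by rewrite cardP expn_gt0 /N addn1.
have hE p q : rail_adj p q = sat2 (G := ColoredGraph col) f (h p) (h q).
  have := eE (e' (inl p)) (e' (inl q)); rewrite !e'K; exact.
have : N <= 18 * #|cut_type k f| + 3 * k.
  apply: (@rail_cut N _ A c); rewrite -?cardP //.
  by move=> p p' b pA p'A bA cpp'; rewrite !hE; apply: cP.
by rewrite /N; lia.
Qed.

Theorem corollary20p10 :
  ~ minimum_unbounded_twin_width subcubic_graphs /\
  ~ (forall D : graph_class,
       unbounded_twin_width D -> transduction_of subcubic_graphs D).
Proof.
split=> [[_ minD]|minD]; apply: subcubic_not_transduced;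
  apply: minD; exact: high_girth_unbounded.
Qed.
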